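(* Let $K$ be a field, let $S=K[t_1,\ldots,t_s]$ be a polynomial ring with the standard grading, let $I\subset S$ be a graded ideal and let $\mathfrak{p}\in{\rm Ass}(I)$. The following hold. (a) If $\mathcal{G}=\{\overline{g}_1,\ldots,\overline{g}_r\}$ is a homogeneous minimal generating set of $(I\colon\mathfrak{p})/I$ (with each $g_i\in S$ homogeneous and $\overline{g}_i=g_i+I$), then $${\rm v}_{\mathfrak{p}}(I)=\min\{\deg(g_i)\mid 1\leq i\leq r\mbox{ and }(I\colon g_i)=\mathfrak{p}\}.$$ (b) ${\rm v}(I)=\min\{{\rm v}_{\mathfrak{q}}(I)\mid \mathfrak{q}\in{\rm Ass}(I)\}$. (c) ${\rm v}_{\mathfrak{p}}(I)\geq\alpha((I\colon\mathfrak{p})/I)$, with equality if $\mathfrak{p}\in{\rm Max}(I)$. (d) If $I$ has no embedded primes, then ${\rm v}(I)=\min\{\alpha((I\colon\mathfrak{q})/I)\mid \mathfrak{q}\in{\rm Ass}(I)\}$.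
   Context: Write $S=\bigoplus_{d\ge 0}S_d$ for the standard grading. For a graded ideal $I$ of $S$ and $f\in S$, $(I\colon f)=\{g\in S\mid gf\in I\}$; for an ideal $\mathfrak{p}$, $(I\colon\mathfrak{p})=\{g\in S\mid g\mathfrak{p}\subset I\}$. A prime ideal $\mathfrak{p}$ of $S$ is an associated prime of $S/I$ if $(I\colon f)=\mathfrak{p}$ for some $d\ge 0$ and some $f\in S_d$; ${\rm Ass}(I)$ is the set of associated primes of $S/I$, and ${\rm Max}(I)$ is the set of maximal elements of ${\rm Ass}(I)$ with respect to inclusion. The v-number of $I$ is ${\rm v}(I):=\min\{d\geq 0\mid \exists\, f\in S_d \text{ and } \mathfrak{p}\in{\rm Ass}(I)\text{ with }(I\colon f)=\mathfrak{p}\}$. For $\mathfrak{p}\in{\rm Ass}(I)$, the local v-number is ${\rm v}_{\mathfrak{p}}(I):=\min\{d\geq 0\mid \exists\, f\in S_d\text{ with }(I\colon f)=\mathfrak{p}\}$. For a graded module $M\neq 0$, $\alpha(M):=\min\{\deg(f)\mid f\in M\setminus\{0\}\}$ (over homogeneous $f$), and $\alpha(0):=0$. *)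

(* Defs.v *)
From HB Require Import structures.
From mathcomp Require Import all_boot all_order all_algebra.
From mathcomp Require Import boolp classical_sets.
From mathcomp Require Import mpoly.

Set Implicit Arguments.
Unset Strict Implicit.
Unset Printing Implicit Defensive.

Import GRing.Theory.
Local Open Scope ring_scope.
Local Open Scope quotient_scope.
Local Open Scope classical_set_scope.

Definition is_min (A : set nat) (m : nat) : Prop :=
  A m /\ forall d, A d -> (m <= d)%N.

(* The least element of A, with value 0 when A is empty. *)
Definition set_min (A : set nat) : nat := xget 0%N [set m | is_min A m].

Section VNumber.
Variables (K : fieldType) (s : nat).
Local Notation S := {mpoly K[s]}.

Definition mpdeg (f : S) : nat := (msize f).-1.

(* [idealr] of ring_quotient is restricted to proper ideals; the unit ideal is
   allowed here, so only the additive part is bundled in I. *)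
Definition graded_ideal (I : zmodClosed S) : Prop :=
  (forall a u : S, u \in I -> a * u \in I) /\
  (forall (d : nat) (f : S), f \in I -> pihomog mdeg d f \in I).

Definition colon (I : {pred S}) (f : S) : {pred S} := [pred g | g * f \in I].

Definition colon_ideal (I p : {pred S}) : set S :=
  [set g | forall h : S, h \in p -> g * h \in I].

Definition Ass (I : {pred S}) : set (prime_idealr S) :=
  [set p | exists (d : nat) (f : S), f \is d.-homog /\ colon I f =i p].

Definition Max (I : {pred S}) : set (prime_idealr S) :=
  [set p | Ass I p /\
           forall q, Ass I q -> {subset p <= q} -> q =i p].

(* Embedded primes are the elements of Ass I that are not minimal in Ass I. *)
Definition embedded_prime (I : {pred S}) : set (prime_idealr S) :=
  [set q | Ass I q /\
           exists p, [/\ Ass I p, {subset p <= q} & ~ (p =i q)]].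

Definition vnumber (I : {pred S}) : nat :=
  set_min [set d | exists (f : S) (p : prime_idealr S),
                     [/\ f \is d.-homog, Ass I p & colon I f =i p]].

Definition local_vnumber (I p : {pred S}) : nat :=
  set_min [set d | exists f : S, f \is d.-homog /\ colon I f =i p].

Section Quotient.
Variable I : zmodClosed S.
Local Notation SI := {ideal_quot I}.

(* The image A/I of A in S/I. *)
Definition quot_set (A : set S) : set SI := [set \pi_SI g | g in A].

Definition quot_homog (d : nat) : set SI :=
  quot_set [set f : S | f \is d.-homog].

(* alpha(M), for M a graded submodule of S/I; alpha(0) = 0 by the default value
   of [set_min]. *)
Definition alpha (M : set SI) : nat :=
  set_min [set d | exists m : SI, [/\ M m, m != 0 & quot_homog d m]].

(* The S-submodule of S/I generated by G; [{ideal_quot I}] carries no S-module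
   structure, so linear combinations are taken on representatives. *)
Definition quot_span (G : set SI) : set SI :=
  [set m | exists (n : nat) (a h : 'I_n -> S),
             (forall i, G (\pi_SI (h i))) /\
             m = \pi_SI (\sum_(i < n) a i * h i)].

Definition min_generating_set (M G : set SI) : Prop :=
  quot_span G = M /\
  forall G' : set SI, G' `<=` G -> quot_span G' = M -> G' = G.

End Quotient.
End VNumber.

Arguments quot_set {K s} I A.
Arguments quot_homog {K s} I d.

(* Main.v *)
From HB Require Import structures.
Require Import Defs.
From mathcomp Require Import all_boot all_order all_algebra.
From mathcomp Require Import boolp classical_sets.
From mathcomp Require Import mpoly.

Import Order.TTheory GRing.Theory.
Local Open Scope ring_scope.
Local Open Scope quotient_scope.
Local Open Scope classical_set_scope.

Set Implicit Arguments.
Unset Strict Implicit.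

(** Everything rests on one observation: if [(I : f) = p] then [f] lies in
    [(I : p)] but not in [I], and conversely an [f] in [(I : p)] outside [I]
    satisfies [p <= (I : f)], so that only the inclusion [(I : f) <= p] is at
    stake.  The local v-number at [p] and the initial degree alpha of [(I : p)/I] are thus minima
    of degrees over two nested sets of homogeneous polynomials, which gives
    the inequality in (c).

    For the equality in (c), take [f] homogeneous in [(I : p)] outside [I].
    Among the colon ideals [(I : h f)], with [h] homogeneous and [h f] outside
    [I], a maximal one exists because polynomial rings are Noetherian
    ([noetherian_max]), and maximality makes it prime; this is an associated
    prime containing [(I : f)], hence [p] ([exists_Ass_above]).  If [p] is
    maximal in [Ass I], the three ideals coincide ([colon_eq_of_Max]).  Without
    embedded primes every associated prime is maximal, so (d) follows from (b)
    and (c), and (b) only exchanges two minima.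

    For (a), write a homogeneous [f] of degree [d] with [(I : f) = p] as a
    combination of the generators modulo [I]; as [I] is graded, every term
    [c i] may be replaced by its component of degree [d], which is still a
    multiple of the generator [g i].  Then [(I : f)] contains the intersection
    of the [(I : c i)], each of which contains [p]; a prime ideal containing a
    finite intersection contains one of the ideals, so [(I : c i) = p] for
    some [i] ([colon_prime_sum]).  Since [(I : g i)] lies between [p] and
    [(I : c i)], the generator [g i] itself has colon ideal [p], and its degree
    is at most [d] because [c i] is nonzero.

    The Noetherian property is obtained from Dickson's lemma: in a strictly
    ascending chain of ideals, choose at each step a new element with least
    leading monomial; one of these monomials divides a later one, and reducing
    the later element by the earlier one contradicts its minimality. *)

(** * Minima of sets of natural numbers *)

Lemma set_minP (A : set nat) : A !=set0 -> is_min A (set_min A).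
Proof.
move=> [n An]; have exA : exists n, `[< A n >] by exists n; apply/asboolP.
apply: xgetPex; have [m /asboolP Am minm] := ex_minnP exA.
by exists m; split=> // d Ad; apply/minm/asboolP.
Qed.

(** * Dickson's lemma *)

(** Take for each next index a position where the sequence reaches its least
    value on the remaining tail. *)
Lemma nondecreasing_subseq (v : nat -> nat) :
  exists2 phi : nat -> nat, {homo phi : i j / (i < j)%N}
    & {homo v \o phi : i j / (i <= j)%N}.
Proof.
have /choice [mu muP] : forall n, exists m,
    (n <= m)%N /\ forall k, (n <= k)%N -> (v m <= v k)%N.
  move=> n; pose A := [set v m | m in [set m | (n <= m)%N]].
  have [|[m le_nm vm] minA] := @set_minP A; first by exists (v n), n => /=.
  by exists m; split=> // k le_nk; rewrite vm; apply: minA; exists k.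
pose fix phi n := if n is k.+1 then mu (phi k).+1 else mu 0%N.
have phi_lt n : (phi n < phi n.+1)%N by case: (muP (phi n).+1).
exists phi; first exact: homo_ltn ltn_trans phi_lt.
apply: homo_leq (@leqnn) (@leq_trans) _ => n /=.
case: n => [|n]; apply: (muP _).2 => //=.
exact: ltn_trans (phi_lt n) (phi_lt n.+1).
Qed.

(** One passes to a nondecreasing subsequence for one variable after another;
    after the last variable, any two terms of the subsequence are comparable. *)
Lemma dickson (s : nat) (u : nat -> 'X_{1..s}) :
  exists i j, (i < j)%N /\ (u i <= u j)%MM.
Proof.
suff [phi phi_lt phiP] : exists2 phi : nat -> nat, {homo phi : i j / (i < j)%N}
    & forall k, k \in enum 'I_s -> forall i j, (i <= j)%N -> (u (phi i) k <= u (phi j) k)%N.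
  exists (phi 0%N), (phi 1%N); split; first exact: phi_lt.
  by apply/mnm_lepP => k; apply: phiP; rewrite ?mem_enum.
elim: (enum 'I_s) => [|k l [phi phi_lt phiP]]; first by exists id.
have [psi psi_lt psiP] := nondecreasing_subseq (fun n => u (phi n) k).
exists (phi \o psi) => [i j /psi_lt/phi_lt //|k' + i j le_ij].
rewrite inE => /predU1P [->|/phiP]; first exact: psiP.
by apply; exact: (ltW_homo psi_lt).
Qed.

(** * Polynomial rings over a field are Noetherian *)

Section Noetherian.
Variables (K : fieldType) (s : nat).
Local Notation S := {mpoly K[s]}.

(** One step of multivariate division: a monomial multiple of [g] cancels the
    leading term of [f]. *)
Lemma mlead_reduction (f g : S) : f != 0 -> g != 0 ->
  (mlead g <= mlead f)%MM ->
  exists a, f - a * g = 0 \/ (mlead (f - a * g) < mlead f)%O.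
Proof.
move=> f0 g0 le_gf.
pose a : S := (mleadc f / mleadc g) *: 'X_[mlead f - mlead g].
have g0' : mleadc g != 0 by rewrite mleadc_eq0.
have f0' : mleadc f != 0 by rewrite mleadc_eq0.
have c0 : mleadc f / mleadc g != 0 by rewrite mulf_neq0 ?invr_eq0.
have X0 : 'X_[mlead f - mlead g] != 0 :> S.
  by rewrite -mleadc_eq0 mleadXm mcoeffX eqxx oner_eq0.
have leadag : mlead (a * g) = mlead f.
  by rewrite mleadM ?scaler_eq0 ?negb_or ?c0 // mleadZ // mleadXm submK.
exists a; have [->|h0] := eqVneq (f - a * g) 0; [by left | right].
rewrite lt_neqAle (le_trans (mleadB_le _ _)) ?leadag ?joinxx // andbT.
apply: contraTneq (mlead_supp h0) => ->.
rewrite -mcoeff_eq0 mcoeffB /a -scalerAl mcoeffZ.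
have := mcoeffMX g (mlead f - mlead g) (mlead g); rewrite submK // mulrC => ->.
by rewrite divfK // subrr.
Qed.

Lemma exists_min_mlead (A : set S) : A !=set0 ->
  exists2 f, A f & forall g, A g -> ~ (mlead g < mlead f)%O.
Proof.
move=> [f Af]; apply: contrapT => nomin.
have [m mE] : exists m, mlead f = m by exists (mlead f).
move: m f Af mE; apply: (well_founded_ind (@ltom_wf s)) => m IH f Af mE.
by apply: nomin; exists f => // g Ag; rewrite mE => lt_gm; exact: IH lt_gm g Ag erefl.
Qed.

(** Closure under [f - a * g] encodes all the ideal axioms at once; unlike
    [idealr_closed], the unit ideal is included. *)
Definition ideal_closed (J : {pred S}) : Prop :=
  0 \in J /\ forall a f g, f \in J -> g \in J -> f - a * g \in J.

Lemma ideal_closedM (J : {pred S}) a f : ideal_closed J -> f \in J -> a * f \in J.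
Proof.
by move=> [J0 Jsub] fJ; have := Jsub (- a) _ _ J0 fJ; rewrite mulNr sub0r opprK.
Qed.

Lemma ideal_closedD (J : {pred S}) f g :
  ideal_closed J -> f \in J -> g \in J -> f + g \in J.
Proof.
by move=> [_ Jsub] fJ gJ; have := Jsub (- 1) _ _ fJ gJ; rewrite mulN1r opprK.
Qed.

Lemma ideal_closed_sum (J : {pred S}) (idJ : ideal_closed J)
    (T : Type) (r : seq T) (P : pred T) (F : T -> S) :
  (forall i, P i -> F i \in J) -> \sum_(i <- r | P i) F i \in J.
Proof.
apply: (big_ind (fun f => f \in J)); first by case: idJ.
by move=> f g; apply: ideal_closedD.
Qed.

(** In a strictly ascending chain, let [f n] have least leading monomial among
    the elements of [J n.+1] outside [J n].  Dickson's lemma gives [i < j] such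
    that [f i] reduces [f j]; the reduction is still in [J j.+1] and outside
    [J j], with a smaller leading monomial. *)
Lemma noetherian_chain (J : nat -> {pred S}) :
  (forall n, ideal_closed (J n)) ->
  (forall n, {subset J n <= J n.+1}) ->
  exists n, {subset J n.+1 <= J n}.
Proof.
move=> idJ subJ; apply: contrapT => strict.
have /choice [f fP] : forall n, exists f : S, [/\ f \in J n.+1, f \notin J n
    & forall g, g \in J n.+1 -> g \notin J n -> ~ (mlead g < mlead f)%O].
  move=> n; pose A : set S := [set f | f \in J n.+1 /\ f \notin J n].
  have [|f [fJ fnJ] minf] := @exists_min_mlead A.
    apply: contrapT => A0; apply: strict; exists n => f fJ.
    by apply: contrapT => /negP fnJ; apply: A0; exists f.
  by exists f; split=> // g gJ gnJ; apply: minf.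
have f0 n : f n != 0.
  by case: (fP n) => _ + _; apply: contraNneq => ->; case: (idJ n).
have monoJ m n : (m <= n)%N -> {subset J m <= J n}.
  move=> /subnK <-; elim: (n - m)%N => // k IH x /IH; exact: subJ.
have [i [j [lt_ij le_ij]]] := dickson (fun n => mlead (f n)).
have [fjJ fjnJ minj] := fP j.
have [fiJ _ _] := fP i.
have [a red] := mlead_reduction (f0 j) (f0 i) le_ij.
have fiJj : f i \in J j by apply: monoJ fiJ.
have hJ : f j - a * f i \in J j.+1 by apply: (idJ _).2 => //; apply: subJ.
have hnJ : f j - a * f i \notin J j.
  apply: contra fjnJ => hJj.
  have /(_ (- a) _ _ hJj fiJj) := (idJ j).2.
  by rewrite mulNr opprK subrK.
case: red => [h0|]; last exact: minj.
by move: hnJ; rewrite h0; case: (idJ j) => ->.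
Qed.

(** The ideals are indexed by an arbitrary type so that a maximal ideal comes
    with the index that produces it. *)
Lemma noetherian_max (T : Type) (P : set T) (J : T -> {pred S}) :
  P !=set0 -> (forall t, P t -> ideal_closed (J t)) ->
  exists2 t, P t & forall t', P t' -> {subset J t <= J t'} ->
                              {subset J t' <= J t}.
Proof.
move=> [t0 Pt0] idJ; apply: contrapT => nomax.
have /choice [nxt nxtP] : forall t, exists t', P t ->
    [/\ P t', {subset J t <= J t'} & ~ {subset J t' <= J t}].
  move=> t; apply: contrapT => not_ex; apply: nomax.
  have Pt : P t by apply: contrapT => nPt; apply: not_ex; exists t.
  exists t => // t' Pt' sub; apply: contrapT => nsub.
  by apply: not_ex; exists t'.
pose t n := iter n nxt t0.
have Pt n : P (t n) by elim: n => // n /nxtP [].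
have [n] := @noetherian_chain (J \o t) (fun n => idJ _ (Pt n))
  (fun n => let: And3 _ sub _ := nxtP _ (Pt n) in sub).
by case: (nxtP _ (Pt n)).
Qed.

End Noetherian.

(** * Homogeneous components and graded prime ideals *)

Section HomogeneousComponents.
Variables (K : fieldType) (s : nat).
Local Notation S := {mpoly K[s]}.
Local Notation comp := (pihomog mdeg).

Lemma pihomogM_homog (d e : nat) (a b : S) : b \is e.-homog ->
  comp d (a * b) = if (e <= d)%N then comp (d - e)%N a * b else 0.
Proof.
move=> hb; elim/mpolyind: a => [|c m q _ _ IH].
  by rewrite mul0r !linear0 mul0r if_same.
rewrite mulrDl !linearD /= IH -scalerAl !linearZ /= pihomogX /=.
have hmb : 'X_[m] * b \is (mdeg m + e)%N.-homog by rewrite dhomogM ?dhomogX.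
have -> : comp d ('X_[m] * b) = if (mdeg m + e == d)%N then 'X_[m] * b else 0.
  by case: eqP => [<-|/eqP ne]; [exact: pihomog_dE | exact: pihomog_ne0 ne hmb].
case: leqP => [le_ed|lt_de].
  have -> : (mdeg m + e == d)%N = (mdeg m == d - e)%N.
    by rewrite -[RHS](eqn_add2r e) subnK.
  rewrite mulrDl -scalerAl.
  by case: eqP; rewrite ?mul0r.
by rewrite gtn_eqF ?scaler0 ?addr0 // (leq_trans lt_de) ?leq_addl.
Qed.

Lemma pihomogM (d : nat) (a b : S) :
  comp d (a * b) = \sum_(j < d.+1) comp (d - j)%N a * comp j b.
Proof.
pose N := maxn d.+1 (msize b).
have le_bN : (msize b <= N)%N by rewrite leq_maxr.
rewrite [in LHS](pihomog_partitionE le_bN) mulr_sumr linear_sum /=.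
rewrite (big_ord_widen N (fun j => comp (d - j)%N a * comp j b)) ?leq_maxl //.
rewrite [RHS]big_mkcond; apply: eq_bigr => j _.
by rewrite (pihomogM_homog _ _ (pihomogP _ _ _)) ltnS.
Qed.

(** Primality of a graded ideal is decided on homogeneous elements: if [a] and
    [b] are outside [J], let [d] and [e] be the largest degrees of components of
    [a] and [b] outside [J].  In the component of degree [d + e] of [a * b], all
    the products but that of these two components lie in [J]. *)
Lemma prime_idealr_closed_homog (J : {pred S}) :
  ideal_closed J ->
  (forall d f, f \in J -> comp d f \in J) ->
  (forall d e f g, f \is d.-homog -> g \is e.-homog ->
     f * g \in J -> (f \in J) || (g \in J)) ->
  prime_idealr_closed J.
Proof.
move=> idJ Jgr Jpr a b abJ.
have top f : f \notin J -> exists2 n, comp n f \notin J &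
    forall k, (n < k)%N -> comp k f \in J.
  move=> fnJ; have exn : exists n, comp n f \notin J.
    apply: contrapT => allJ; case/negP: fnJ.
    rewrite (pihomog_partitionE (leqnn (msize f))).
    apply: (ideal_closed_sum idJ) => i _.
    by apply: contrapT => /negP fiJ; apply: allJ; exists i.
  have bound n : comp n f \notin J -> (n <= msize f)%N.
    apply: contraR; rewrite -ltnNge => lt_fn.
    rewrite [f](pihomog_partitionE (leqnn (msize f))) linear_sum /=.
    apply: (ideal_closed_sum idJ) => i _; rewrite (pihomog_ne0 _ (pihomogP _ _ _)) ?idJ.1 //.
    by rewrite ltn_eqF // (ltn_trans _ lt_fn).
  have [n fnnJ maxn] := ex_maxnP exn bound.
  exists n => // k lt_nk; apply: contraTT lt_nk => /maxn.
  by rewrite -leqNgt.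
apply: contrapT => /negP; rewrite negb_or => /andP [/top [d adJ ltd] /top [e beJ lte]].
suff /(Jpr _ _ _ _ (pihomogP mdeg d a) (pihomogP mdeg e b)) :
    comp d a * comp e b \in J by rewrite (negbTE adJ) (negbTE beJ).
(* In degree d + e the product of the two top components has index e. *)
have lt_e : (e < (d + e).+1)%N by rewrite ltnS leq_addl.
have := Jgr (d + e)%N _ abJ.
rewrite pihomogM (bigD1 (Ordinal lt_e)) //= addnK => tot.
set rest := (X in _ + X) in tot.
suff restJ : rest \in J.
  by have := idJ.2 1 _ _ tot restJ; rewrite mul1r addrK.
apply: (ideal_closed_sum idJ) => j ne_je; have [lt_ej|lt_je] := ltnP e j.
  by apply: ideal_closedM => //; apply: lte.
rewrite mulrC; apply: ideal_closedM => //; apply: ltd.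
have {}lt_je: (j < e)%N by rewrite ltn_neqAle lt_je andbT.
by rewrite -addnBA ?(ltnW lt_je)// -[X in (X < _)%N]addn0 ltn_add2l subn_gt0.
Qed.

End HomogeneousComponents.

(** * Colon ideals and associated primes *)

Section AssociatedPrimes.
Variables (K : fieldType) (s : nat).
Local Notation S := {mpoly K[s]}.
Local Notation comp := (pihomog mdeg).

Lemma prime_idealr_of_pred (J : {pred S}) :
  ideal_closed J -> 1 \notin J -> prime_idealr_closed J ->
  exists q : prime_idealr S, q =i J.
Proof.
move=> idJ J1 prJ.
have clJ : idealr_closed J.
  split=> // [|a f g fJ gJ]; first by case: idJ.
  by rewrite ideal_closedD // ideal_closedM.
pose idM := isIdealr.Build _ J clJ.
pose prM := isPrimeIdealrClosed.Build _ J prJ.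
pose q : prime_idealr S := HB.pack J idM prM.
by exists q.
Qed.

Variables (I : zmodClosed S).
Hypothesis hI : graded_ideal I.

Lemma graded_ideal_closed : ideal_closed I.
Proof.
split; first exact: rpred0.
by move=> a f g fI gI; rewrite rpredB // hI.1.
Qed.

Lemma colonE (f g : S) : (g \in colon I f) = (g * f \in I).
Proof. by []. Qed.

Lemma colon_ideal_closed (f : S) : ideal_closed (colon I f).
Proof.
split; first by rewrite colonE mul0r rpred0.
move=> a g h; rewrite !colonE => gI hI'.
by rewrite mulrBl -mulrA; apply: graded_ideal_closed.2.
Qed.

Lemma colon_graded (e k : nat) (f g : S) : f \is e.-homog for mdeg ->
  g \in colon I f -> comp k g \in colon I f.
Proof.
move=> hf; rewrite !colonE => gfI.
have := hI.2 (k + e)%N _ gfI.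
by rewrite (pihomogM_homog _ _ hf) leq_addl addnK.
Qed.

Lemma colonM (a f : S) : {subset colon I f <= colon I (a * f)}.
Proof. by move=> g; rewrite !colonE mulrCA => /(hI.1 a). Qed.

(** Take [h] homogeneous with [h * f] outside [I] and [(I : h f)] maximal.  Its
    primality is tested on homogeneous [a] and [b]: if [a b] is in [(I : h f)]
    and [a] is not, then [(I : a h f)] contains [(I : h f)] and [b]; by
    maximality it is [(I : h f)], so [b] belongs to it. *)
Lemma exists_Ass_above (d : nat) (f : S) : f \is d.-homog for mdeg -> f \notin I ->
  exists2 q : prime_idealr S, Ass I q & {subset colon I f <= q}.
Proof.
move=> hf fnI.
pose P : set S := [set h | h \is homog mdeg /\ h * f \notin I].
have [||h [/homogP [e hh] hfnI] maxh] := @noetherian_max K s S P (fun h => colon I (h * f)).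
- by exists 1; split; [apply/homogP; exists 0%N; apply: dhomog1 | rewrite mul1r].
- by move=> h _; apply: colon_ideal_closed.
have hhf := dhomogM hh hf.
have prJ : prime_idealr_closed (colon I (h * f)).
  apply: prime_idealr_closed_homog; first exact: colon_ideal_closed.
    by move=> k g; apply: colon_graded hhf.
  move=> i j a b ha hb; rewrite colonE => abhf; apply/orP.
  have [|anJ] := boolP (a \in colon I (h * f)); [by left | right].
  have Pah : P (a * h).
    by split; [apply/homogP; exists (i + e)%N; apply: dhomogM | rewrite -mulrA].
  apply: (maxh _ Pah); first by move=> g /(colonM a); rewrite mulrA.
  by rewrite colonE -mulrA mulrA [b * a]mulrC.
have J1 : 1 \notin colon I (h * f) by rewrite colonE mul1r.
have [q qE] := prime_idealr_of_pred (colon_ideal_closed (h * f)) J1 prJ.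
exists q; last by move=> g /(colonM h); rewrite qE.
by exists (e + d)%N, (h * f); split=> // g; rewrite qE.
Qed.

End AssociatedPrimes.

(** * v-numbers and initial degrees *)

Section VNumbers.
Variables (K : fieldType) (s : nat).
Local Notation S := {mpoly K[s]}.
Local Notation comp := (pihomog mdeg).
Variables (I : zmodClosed S).
Hypothesis hI : graded_ideal I.
Local Notation SI := {ideal_quot I}.

Lemma colon_prime_witness (q : prime_idealr S) (f : S) :
  colon I f =i q -> f \notin I /\ colon_ideal I q f.
Proof.
move=> qE; split=> [|h]; last by rewrite -qE colonE mulrC.
by apply/negP => fI; have := idealr1 q; rewrite -qE colonE mul1r fI.
Qed.

(** Membership in the quotient does not depend on the representative, because
    [(I : J)] contains [I]. *)
Lemma pi_quot_set_colon (J : {pred S}) (f : S) :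
  quot_set I (colon_ideal I J) (\pi_SI f) <-> colon_ideal I J f.
Proof.
split=> [[g gJ /eqP]|fJ]; last by exists f.
rewrite -Quotient.idealrBE => gfI h hJ.
rewrite -[f](subKr g) mulrBl rpredB ?gJ // mulrC.
exact: hI.1.
Qed.

Lemma alphaE (J : {pred S}) :
  alpha (quot_set I (colon_ideal I J)) =
  set_min [set d | exists f : S, [/\ f \is d.-homog for mdeg, f \notin I & colon_ideal I J f]].
Proof.
congr set_min; apply/seteqP; split=> d /=.
  move=> [m [mJ m0 [f hf fm]]]; exists f; split=> //.
    by apply: contra m0 => fI; rewrite -fm -(raddf0 \pi_SI) -Quotient.idealrBE subr0.
  by apply/pi_quot_set_colon; rewrite fm.
move=> [f [hf fnI fJ]]; exists (\pi_SI f); split; last by exists f.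
  exact/pi_quot_set_colon.
by apply: contra fnI; rewrite -(raddf0 \pi_SI) -Quotient.idealrBE subr0.
Qed.

Lemma local_vnumberP (q : prime_idealr S) : Ass I q ->
  is_min [set d | exists f : S, f \is d.-homog for mdeg /\ colon I f =i q] (local_vnumber I q).
Proof. by move=> [d [f fq]]; apply: set_minP; exists d, f. Qed.

Lemma alphaP (q : prime_idealr S) : Ass I q ->
  is_min [set d | exists f : S, [/\ f \is d.-homog for mdeg, f \notin I & colon_ideal I q f]]
    (alpha (quot_set I (colon_ideal I q))).
Proof.
move=> [d [f [hf fq]]]; rewrite alphaE; apply: set_minP; exists d, f.
by have [] := colon_prime_witness fq.
Qed.

Lemma alpha_le_local_vnumber (q : prime_idealr S) : Ass I q ->
  (alpha (quot_set I (colon_ideal I q)) <= local_vnumber I q)%N.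
Proof.
move=> qA; have [[f [hf fq]] _] := local_vnumberP qA; have [_ minA] := alphaP qA.
by apply: minA; exists f; have [] := colon_prime_witness fq.
Qed.

(** [q] is contained in [(I : f)], which is contained in an associated prime; by
    maximality of [q] that prime is [q]. *)
Lemma colon_eq_of_Max (q : prime_idealr S) (d : nat) (f : S) : Max I q ->
  f \is d.-homog for mdeg -> f \notin I -> colon_ideal I q f -> colon I f =i q.
Proof.
move=> [_ maxq] hf fnI fq.
have sub_qf : {subset q <= colon I f} by move=> h /fq; rewrite colonE mulrC.
have [q' q'A sub_fq'] := exists_Ass_above hI hf fnI.
have q'E := maxq _ q'A (fun h hq => sub_fq' h (sub_qf h hq)).
by move=> h; apply/idP/idP => [/sub_fq'|/sub_qf //]; rewrite q'E.
Qed.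

Lemma local_vnumber_Max (q : prime_idealr S) : Max I q ->
  local_vnumber I q = alpha (quot_set I (colon_ideal I q)).
Proof.
move=> qM; have [qA _] := qM.
apply/eqP; rewrite eqn_leq alpha_le_local_vnumber // andbT.
have [[f [hf fnI fq]] _] := alphaP qA; have [_ minv] := local_vnumberP qA.
by apply: minv; exists f; split=> //; apply: colon_eq_of_Max hf fnI fq.
Qed.

Lemma vnumber_min (p : prime_idealr S) : Ass I p ->
  is_min [set local_vnumber I q | q in Ass I] (vnumber I).
Proof.
move=> pA; have [d0 [f0 [hf0 f0p]]] := pA.
have [|[f [q [hf qA fq]]] minv] := 
  @set_minP [set d | exists (f : S) (q : prime_idealr S),
    [/\ f \is d.-homog for mdeg, Ass I q & colon I f =i q]].
  by exists d0, f0, p.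
have le_v q' : Ass I q' -> (vnumber I <= local_vnumber I q')%N.
  move=> q'A; have [[g [hg gq']] _] := local_vnumberP q'A.
  by apply: minv; exists g, q'.
split=> [|_ [q' q'A <-]]; last exact: le_v.
exists q => //; apply/eqP; rewrite eqn_leq le_v // andbT.
by have [_ minq] := local_vnumberP qA; apply: minq; exists f.
Qed.

Lemma Max_of_no_embedded (q : prime_idealr S) :
  (forall q', ~ embedded_prime I q') -> Ass I q -> Max I q.
Proof.
move=> noemb qA; split=> // q' q'A sub; apply: contrapT => ne.
apply: (noemb q'); split=> //; exists q; split=> // qq'; apply: ne => h.
by rewrite qq'.
Qed.

(** If every [(I : c i)] had an element [x i] outside [q], the product of the
    [x i] would be outside [q] and yet multiply every [c i], hence [f], into
    [I]. *)
Lemma colon_prime_sum (q : prime_idealr S) (r : nat) (c : 'I_r -> S) (f : S) :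
  colon I f =i q -> f - \sum_i c i \in I -> (forall i, colon_ideal I q (c i)) ->
  exists i, colon I (c i) =i q.
Proof.
move=> fq fcI cq; apply: contrapT => noi.
have /choice [x xP] : forall i, exists x, x * c i \in I /\ x \notin q.
  move=> i; apply: contrapT => nox; apply: noi; exists i => x.
  rewrite colonE; apply/idP/idP => [xcI|/cq]; last by rewrite mulrC.
  by apply: contrapT => /negP xnq; apply: nox; exists x.
have : \prod_i x i \notin q.
  apply: (big_ind (fun y => y \notin q)); first by rewrite idealr1.
    by move=> y z yq zq; rewrite prime_idealrM negb_or yq.
  by move=> i _; case: (xP i).
rewrite -fq colonE => /negP; apply.
rewrite -[f](subrK (\sum_i c i)) mulrDr rpredD //; first exact: hI.1.
rewrite mulr_sumr; apply: rpred_sum => i _.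
by rewrite (bigD1 i) //= mulrAC mulrC hI.1 //; case: (xP i).
Qed.

(** An element of the span is a combination of arbitrary representatives of
    classes of generators; collecting the coefficients of equal generators turns
    it into a combination indexed by the generators themselves. *)
Lemma quot_span_family (r : nat) (g : 'I_r -> S) (f : S) :
  quot_span (I := I) [set \pi_SI (g i) | i in [set: 'I_r]] (\pi_SI f) ->
  exists b : 'I_r -> S, f - \sum_i b i * g i \in I.
Proof.
move=> [n [a [h [hG /eqP]]]]; rewrite -Quotient.idealrBE => fah.
have /choice [j jP] : forall k, exists j, h k - g j \in I.
  by move=> k; have [j _ /esym/eqP] := hG k; rewrite -Quotient.idealrBE; exists j.
exists (fun i => \sum_(k | j k == i) a k).
suff e : \sum_i (\sum_(k | j k == i) a k) * g i = \sum_k a k * g (j k).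
  rewrite e -(subrK (\sum_k a k * h k) f) -addrA rpredD // -sumrB rpred_sum // => k _.
  by rewrite -mulrBr hI.1.
rewrite [RHS](partition_big j xpredT) //=; apply: eq_bigr => i _.
by rewrite mulr_suml; apply: eq_bigr => k /eqP ->.
Qed.

(** A generator attains the minimum because [q] is one of the [(I : c i)], for
    the terms [c i] of a minimal [f], and [(I : g i)] is squeezed between
    them: [q <= (I : g i) <= (I : c i) = q]. *)
Lemma local_vnumber_generators (q : prime_idealr S) (r : nat) (g : 'I_r -> S) :
  Ass I q -> (forall i, g i \is homog mdeg) ->
  quot_span (I := I) [set \pi_SI (g i) | i in [set: 'I_r]] = quot_set I (colon_ideal I q) ->
  is_min [set d | exists i, colon I (g i) =i q /\ d = mpdeg (g i)] (local_vnumber I q).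
Proof.
move=> qA hg spanG; have [[f [hf fq]] minv] := local_vnumberP qA.
set d := local_vnumber I q in hf minv *.
have gdeg i : g i \is (mpdeg (g i)).-homog for mdeg by rewrite -homog_msize.
have le_d i : colon I (g i) =i q -> (d <= mpdeg (g i))%N.
  by move=> giq; apply: minv; exists (g i).
have gq i : colon_ideal I q (g i).
  apply/pi_quot_set_colon; rewrite -spanG.
  exists 1%N, (fun=> 1), (fun=> g i); split=> [_|]; first by exists i.
  by rewrite big_ord1 mul1r.
have [b fbI] : exists b : 'I_r -> S, f - \sum_i b i * g i \in I.
  apply: quot_span_family; rewrite spanG; apply/pi_quot_set_colon.
  by have [] := colon_prime_witness fq.
(* As I is graded, the congruence may be projected to degree d. *)
have fcI : f - \sum_i comp d (b i * g i) \in I.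
  by have := hI.2 d _ fbI; rewrite pihomogB (pihomog_dE hf) (linear_sum (pihomog _ d)).
have cE i : exists c, comp d (b i * g i) = c * g i.
  rewrite (pihomogM_homog _ _ (gdeg i)); case: ifP => _; last by exists 0; rewrite mul0r.
  by eexists.
have cq i : colon_ideal I q (comp d (b i * g i)).
  by have [c ->] := cE i; move=> h hq; rewrite -mulrA hI.1 // gq.
have [i iq] := colon_prime_sum fq fcI cq.
have giq : colon I (g i) =i q.
  have [c ciE] := cE i; move=> h; apply/idP/idP => [/(colonM hI c)|/gq].
    by rewrite -ciE iq.
  by rewrite colonE mulrC.
split=> [|_ [j [jq ->]]]; last exact: le_d.
exists i; split=> //; apply/eqP; rewrite eqn_leq le_d //=.
(* If g i had degree more than d, the component of degree d of b i * g i
   would be zero. *)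
have [cnI _] := colon_prime_witness iq.
move: cnI; rewrite (pihomogM_homog _ _ (gdeg i)).
by case: leqP; rewrite ?rpred0.
Qed.

End VNumbers.

Theorem theorem3p2 (K : fieldType) (s : nat) (I : zmodClosed {mpoly K[s]})
    (hI : graded_ideal I) (p : prime_idealr {mpoly K[s]}) (hp : Ass I p) :
  (* (a) *)
  (forall (r : nat) (g : 'I_r -> {mpoly K[s]}),
     (forall i, g i \is homog mdeg) ->
     min_generating_set (quot_set I (colon_ideal I p))
       [set \pi_{ideal_quot I} (g i) | i in [set: 'I_r]] ->
     is_min [set d | exists i, colon I (g i) =i p /\ d = mpdeg (g i)]
       (local_vnumber I p))
  /\
  (* (b) *)
  is_min [set local_vnumber I q | q in Ass I] (vnumber I)
  /\
  (* (c) *)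
  ((alpha (quot_set I (colon_ideal I p)) <= local_vnumber I p)%N /\
   (Max I p -> local_vnumber I p = alpha (quot_set I (colon_ideal I p))))
  /\
  (* (d) *)
  ((forall q, ~ embedded_prime I q) ->
   is_min [set alpha (quot_set I (colon_ideal I q)) | q in Ass I] (vnumber I)).
Proof.
split.
  by move=> r g hg [spanG _]; exact: local_vnumber_generators hp hg spanG.
split; first exact: vnumber_min hp.
split; first by split; [exact: alpha_le_local_vnumber | exact: local_vnumber_Max].
move=> noemb.
suff <- : [set local_vnumber I q | q in Ass I] =
          [set alpha (quot_set I (colon_ideal I q)) | q in Ass I].
  exact: vnumber_min hp.
apply: eq_imagel => q qA.
exact/local_vnumber_Max/Max_of_no_embedded.
Qed.
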